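(* Let $a>0$, $\delta>0$, $k_{\max}>0$, and let $f$ and $f_{\mathrm{app}}$ be two indicator functions of intervals contained in $(-a,a)$, each of these intervals having length greater than $\delta$. Let $d(k)=\Gamma(f)(k)$ and $d_{\mathrm{app}}(k)=\Gamma(f_{\mathrm{app}})(k)$ for $k\in(0,2k_{\max})$, and let $c(k)=\left(\int_k^{+\infty}\operatorname{sinc}^2(x)\,dx\right)^{1/2}$. Then there exists a constant $M>0$ such that $$\|f-f_{\mathrm{app}}\|_{L^2(-a,a)}^2\le \frac4\pi\|d-d_{\mathrm{app}}\|_{\mathrm H}^2+M\,c(\delta\,k_{\max}).$$
   Context: For $f\in L^2(\mathbb R)$ with compact support, $\Gamma(f)(\omega)=\frac{i}{2\omega}\int_{\mathbb R} f(z)e^{i\omega z}\,dz$ for $\omega>0$. For a function $v$ defined on an interval $I\subset(0,+\infty)$, $\|v\|_{\mathrm H}^2=\int_I\omega^2|v(\omega)|^2\,d\omega$; here $I=(0,2k_{\max})$. Also $\operatorname{sinc}(x)=\sin(x)/x$. *)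

(* Defs.v *)
From HB Require Import structures.
From mathcomp Require Import all_boot all_order all_algebra.
From mathcomp Require Import complex.
From mathcomp Require Import all_classical all_reals all_analysis.

Set Implicit Arguments.
Unset Strict Implicit.
Unset Printing Implicit Defensive.

Import Order.TTheory GRing.Theory Num.Theory.
Import numFieldNormedType.Exports.

Local Open Scope classical_set_scope.
Local Open Scope ring_scope.
Local Open Scope complex_scope.

Section defs.
Context {R : realType}.
Local Notation mu := (@lebesgue_measure R).

(* The library integrates real-valued functions only: Lebesgue integral over R
   of a complex-valued function, componentwise. *)
Definition cintegral (f : R -> R[i]) : R[i] :=
  Rintegral mu setT (fun z => complex.Re (f z)) +i*
  Rintegral mu setT (fun z => complex.Im (f z)).

(* exp(i t), by Euler's formula *)
Definition expi (t : R) : R[i] := cos t +i* sin t.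

(* Only meaningful for 0 < omega and f square-integrable with compact
   support. The scope on 'i selects 0 +i* 1 rather than the generic
   imaginary unit of numClosedFieldType. *)
Definition Gamma (f : R -> R[i]) (omega : R) : R[i] :=
  'i%C / (2 * omega)%:C * cintegral (fun z => f z * expi (omega * z)).

(* The square of ||v||_H on I; extended-real-valued, +oo when divergent. *)
Definition Hnorm_sq (I : interval R) (v : R -> R[i]) : \bar R :=
  (\int[mu]_(omega in [set` I])
     (omega ^+ 2 * ComplexField.Normc.normc (v omega) ^+ 2)%:E)%E.

(* Here sinc 0 = 0; this does not affect the integral below. *)
Definition sinc (x : R) : R := sin x / x.

Definition sinc_tail (k : R) : R :=
  Num.sqrt (Rintegral mu `[k, +oo[ (fun x => sinc x ^+ 2)).

Definition L2norm (I : interval R) (g : R -> R) : \bar R :=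
  ('N[mu]_2%:E [EFin \o (g \_ [set` I])])%E.

End defs.

(* Main.v *)
Require Import Defs.
From HB Require Import structures.
From mathcomp Require Import all_boot all_order all_algebra.
From mathcomp Require Import complex.
From mathcomp Require Import all_classical all_reals all_analysis.
From mathcomp Require Import measurable_realfun.
From mathcomp Require Import ring lra.

Set Implicit Arguments.
Unset Strict Implicit.
Unset Printing Implicit Defensive.

Import Order.TTheory GRing.Theory Num.Theory.
Import numFieldNormedType.Exports.

Local Open Scope classical_set_scope.
Local Open Scope ring_scope.
Local Open Scope complex_scope.

(** Let g be the difference of the two indicators and g^ its Fourier transform.
    Since |g^(w)|^2 = 4 w^2 |Gamma g (w)|^2 for w > 0, the term
    (4 / pi) ||d - dapp||_H^2 is (1 / pi) times the integral of |g^|^2 over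
    ]0, 2 kmax[. As g is real, |g^|^2 is even and Plancherel's theorem says that
    ||g||^2 is (1 / pi) times the integral of |g^|^2 over the whole half-line,
    so what has to be bounded is the tail of |g^|^2 beyond 2 kmax.

    Plancherel's theorem for g is an explicit computation. Expanding |g^|^2 at
    the four endpoints ([ft_itvB_sqrE]) leaves a combination of the functions
    (1 - cos (t w)) / w^2, where t runs over differences of endpoints; the
    constant terms cancel because the jumps of g sum to 0. Each of these
    functions has integral pi |t| / 2 over the half-line ([integral_fejer]), and
    the resulting combination of distances between endpoints is exactly the
    measure of the symmetric difference of the two intervals
    ([integral_ft_itvB_sqr], [L2norm_indicB]).

    For the tail, |g^|^2 is at most twice the sum of the squared transforms of
    the two indicators. An interval of length L has squared transform
    (L sinc (w L / 2))^2, whose tail beyond 2 kmax is 2 L c(L kmax)^2 after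
    rescaling ([integral_fejer_tail]); moreover delta <= L <= 2 a and c is
    nonincreasing. The tail of |g^|^2 is thus at most 16 a c(delta kmax)^2
    ([ft_itvB_sqr_tail]), and c <= pi turns the square into a first power:
    M = 16 a works, and depends on a alone. *)

(** * Measurability and integration *)

Section fubini_tonelli_on_rectangles.
Local Open Scope ereal_scope.

(** Tonelli's theorem for the extension of f by 0 outside the rectangle. *)
Lemma fubini_tonelli_setX d1 d2 (T1 : measurableType d1)
    (T2 : measurableType d2) (R : realType)
    (m1 : {sigma_finite_measure set T1 -> \bar R})
    (m2 : {sigma_finite_measure set T2 -> \bar R})
    (A : set T1) (B : set T2) (f : T1 * T2 -> \bar R) :
  measurable A -> measurable B -> measurable_fun (A `*` B) f ->
  (forall z, (A `*` B) z -> 0 <= f z) ->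
  \int[m1]_(x in A) \int[m2]_(y in B) f (x, y) =
  \int[m2]_(y in B) \int[m1]_(x in A) f (x, y).
Proof.
move=> mA mB mf f0.
have mAB : measurable (A `*` B) by exact: measurableX.
pose g := f \_ (A `*` B).
transitivity (\int[m1]_x \int[m2]_y g (x, y)).
  rewrite integral_mkcond; apply: eq_integral => x _.
  rewrite patchE; case: ifPn => [/set_mem Ax|/negP xA].
    rewrite integral_mkcond; apply: eq_integral => y _.
    by rewrite /g !patchE in_setX (mem_set Ax).
  rewrite integral0_eq// => y _; rewrite /g patchE in_setX.
  by move/negP/negbTE : xA => ->.
rewrite fubini_tonelli; last 2 first.
- by apply/measurable_restrict => //; rewrite setTI.
- by apply: erestrict_ge0.
symmetry; rewrite integral_mkcond; apply: eq_integral => y _.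
rewrite patchE; case: ifPn => [/set_mem By|/negP yB].
  rewrite integral_mkcond; apply: eq_integral => x _.
  by rewrite /g !patchE in_setX (mem_set By) andbT.
rewrite integral0_eq// => x _; rewrite /g patchE in_setX.
by move/negP/negbTE : yB => ->; rewrite andbF.
Qed.

End fubini_tonelli_on_rectangles.

Section integration.
Context {R : realType}.
Local Notation mu := (@lebesgue_measure R).
Implicit Types k p q : R.

(** The inverse is discontinuous at 0 only, and a point is a measurable set. *)
Lemma measurable_invr : measurable_fun [set: R] (@GRing.inv R).
Proof.
have -> : [set: R] = [set 0] `|` [set~ 0] by rewrite setUv.
apply/measurable_funU => //; first exact: measurableC.
split; first exact: measurable_fun_set1.
apply: open_continuous_measurable_fun.
  by apply: closed_openC; exact: closed_eq.
by move=> x /set_mem /= /eqP x0; apply: (@continuousV _ _ id x) => //; exact: cvg_id.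
Qed.

Lemma measurable_sin : measurable_fun [set: R] (@sin R).
Proof. by apply: continuous_measurable_fun; exact: continuous_sin. Qed.

Lemma measurable_cos : measurable_fun [set: R] (@cos R).
Proof. by apply: continuous_measurable_fun; exact: continuous_cos. Qed.

(** An antiderivative on the whole line is in particular continuous at the left
    endpoint, as the fundamental theorem of calculus requires. *)
Lemma ge0_integral_is_derivey (f F : R -> R) (a l : R) :
  (forall x, is_derive x (1:R) F (f x)) -> continuous f ->
  (forall x, a <= x -> 0 <= f x) -> F x @[x --> +oo] --> l ->
  (\int[mu]_(x in `[a, +oo[) (f x)%:E = (l - F a)%:E)%E.
Proof.
move=> dF cf f0 Fl.
have drF x : derivable F x 1 by have [] := dF x.
rewrite (@ge0_continuous_FTC2y R f F a l) ?EFinB//.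
- exact: continuous_subspaceT.
- apply: cvg_at_right_filter; apply: differentiable_continuous.
  exact/derivable1_diffP.
- by move=> x _; rewrite derive1E; apply: derive_val.
Qed.

Lemma cvgy_expRNM (k : R) : 0 < k -> expR (- (k * x)) @[x --> +oo] --> (0 : R).
Proof.
move=> k0; apply: (cvg_comp (fun x => k * x) (fun x => expR (- x))).
  by apply: gt0_cvgMry => //; exact: cvg_id.
exact: cvgr_expR.
Qed.

Lemma cvgy0_le_expRN (F : R -> R) (C k : R) : 0 < k ->
  (forall x, 0 <= x -> `|F x| <= C * expR (- (k * x))) ->
  F x @[x --> +oo] --> (0 : R).
Proof.
move=> k0 FC; have e0 := cvgy_expRNM k0.
have Ce0 : C * expR (- (k * x)) @[x --> +oo] --> (0 : R).
  by rewrite -[X in _ --> X](mulr0 C); apply: cvgMl_tmp.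
apply: norm_cvg0; apply: squeeze_cvgr (cvg_cst 0) Ce0.
by near=> x; rewrite normr_ge0 /= FC.
Unshelve. all: by end_near. Qed.

Lemma derivable_continuous (f : R -> R) :
  (forall x, derivable f x 1) -> continuous f.
Proof.
by move=> df x; apply: differentiable_continuous; apply/derivable1_diffP.
Qed.

(** Endpoints are negligible, so an interval of any type can be closed first. *)
Lemma Rintegral_itv_is_derive (f F : R -> R) p q (b b' : bool) : p < q ->
  (forall x, is_derive x (1:R) F (f x)) -> continuous f ->
  Rintegral mu [set` Interval (BSide b p) (BSide b' q)] f = F q - F p.
Proof.
move=> pq dF cf; have drF x : derivable F x 1 by have [] := dF x.
have cF : continuous F by exact: derivable_continuous.
rewrite /Rintegral integral_itv_bndoo; last first.
  apply/measurable_EFinP; apply: measurable_funTS.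
  exact: continuous_measurable_fun.
rewrite -(@integral_itv_bndoo _ _ _ _ true false); last first.
  apply/measurable_EFinP; apply: measurable_funTS.
  exact: continuous_measurable_fun.
rewrite (@continuous_FTC2 _ f F)//.
- exact: continuous_subspaceT.
- split; first by move=> x _.
  + exact/cvg_at_right_filter/cF.
  + exact/cvg_at_left_filter/cF.
- by move=> x _; rewrite derive1E; apply: derive_val.
Qed.

Lemma ge0_integralD_EFin (D : set R) (f g : R -> R) : measurable D ->
  measurable_fun [set: R] f -> measurable_fun [set: R] g ->
  (forall x, 0 <= f x) -> (forall x, 0 <= g x) ->
  (\int[mu]_(x in D) (f x + g x)%:E =
   \int[mu]_(x in D) (f x)%:E + \int[mu]_(x in D) (g x)%:E)%E.
Proof.
move=> mD mf mg f0 g0.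
transitivity (\int[mu]_(x in D) ((f x)%:E + (g x)%:E))%E; first by [].
rewrite ge0_integralD//.
- by move=> x _; rewrite lee_fin.
- by apply/measurable_EFinP; apply: measurable_funTS.
- by move=> x _; rewrite lee_fin.
- by apply/measurable_EFinP; apply: measurable_funTS.
Qed.

Lemma ge0_integralZ_EFin (D : set R) (c : R) (f : R -> R) : measurable D ->
  0 <= c -> measurable_fun [set: R] f -> (forall x, 0 <= f x) ->
  (\int[mu]_(x in D) (c * f x)%:E = c%:E * \int[mu]_(x in D) (f x)%:E)%E.
Proof.
move=> mD c0 mf f0.
transitivity (\int[mu]_(x in D) (c%:E * (f x)%:E))%E; first by [].
rewrite ge0_integralZl_EFin//.
- by move=> x _; rewrite lee_fin.
- by apply/measurable_EFinP; apply: measurable_funTS.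
Qed.

End integration.

(** * The kernel (1 - cos (t x)) / x^2 and its integral *)

Section fejer_kernel.
Context {R : realType}.
Local Notation mu := (@lebesgue_measure R).
Implicit Types s t x y w : R.

(** The weight s e^(-sx) is what represents x^-2 as a positive superposition of
    exponentials, against which 1 - cos (t x) is integrated below. *)
Lemma integral_id_expRN (x : R) : 0 < x ->
  (\int[mu]_(s in `[0%R, +oo[) (s * expR (- (s * x)))%:E = (x ^- 2)%:E)%E.
Proof.
move=> x0.
pose F (s : R) := - (s / x + x ^- 2) * expR (- (s * x)).
have dF s : is_derive s (1 : R) F (s * expR (- (s * x))).
  rewrite /F; apply: is_derive_eq.
  by rewrite /GRing.scale /=; field; rewrite gt_eqF.
rewrite (ge0_integral_is_derivey (F := F) (l := 0))//.
- rewrite /F !mul0r !add0r oppr0 expR0 mulr1 opprK; congr EFin.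
- by apply: derivable_continuous => s; exact: ex_derive.
- by move=> s s0; rewrite mulr_ge0// expR_ge0.
- apply: (cvgy0_le_expRN (C := 2 * x ^- 2) (k := x / 2)); first by rewrite divr_gt0.
  move=> s s0.
  have [e1 e0] := (expR_ge1Dx (x / 2 * s), expR_ge0 (- (x / 2 * s))).
  (* Half of the exponential absorbs the linear factor, since
     1 + u <= e^u at u = x s / 2; the other half gives the decay. *)
  have eE : expR (- (s * x)) = expR (- (x / 2 * s)) ^+ 2.
    by rewrite expr2 -expRD; congr expR; field.
  have e11 : expR (x / 2 * s) * expR (- (x / 2 * s)) = 1.
    by rewrite -expRD subrr expR0.
  rewrite /F normrM normrN (ger0_norm (expR_ge0 _)) ger0_norm; last first.
    by rewrite addr_ge0 ?invr_ge0 ?exprn_ge0 ?divr_ge0 ?(ltW x0).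
  rewrite eE expr2 mulrA ler_wpM2r//.
  rewrite (_ : s / x + x ^- 2 = x ^- 2 * (s * x + 1)); last by field; rewrite gt_eqF.
  have xV0 : 0 <= x ^- 2 by rewrite invr_ge0 exprn_ge0 ?(ltW x0).
  rewrite (mulrC 2) -[leLHS]mulrA; apply: ler_wpM2l => //.
  rewrite -[leRHS]mulr1 -[X in _ <= _ * X]e11 [leRHS]mulrA.
  by apply: ler_wpM2r => //; lra.
Qed.

(** The Laplace transform of 1 - cos (t x); its factor 1 / s cancels the weight s
    of [integral_id_expRN]. *)
Lemma integral_one_sub_cos_expRN s t : 0 < s ->
  (\int[mu]_(x in `[0%R, +oo[) ((1 - cos (t * x)) * expR (- (s * x)))%:E =
   (t ^+ 2 / (s * (s ^+ 2 + t ^+ 2)))%:E)%E.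
Proof.
move=> s0.
have st : s ^+ 2 + t ^+ 2 != 0.
  by rewrite gt_eqF// ltr_pwDl ?sqr_ge0 ?exprn_gt0.
pose F (x : R) := expR (- (s * x)) *
  ((s * cos (t * x) - t * sin (t * x)) / (s ^+ 2 + t ^+ 2) - s^-1).
have dF x : is_derive x (1 : R) F ((1 - cos (t * x)) * expR (- (s * x))).
  rewrite /F; apply: is_derive_eq.
  by rewrite /GRing.scale /=; field; rewrite st gt_eqF.
rewrite (ge0_integral_is_derivey (F := F) (l := 0))//.
- rewrite /F !mulr0 oppr0 expR0 cos0 sin0; congr EFin.
  by field; rewrite st gt_eqF.
- by apply: derivable_continuous => x; exact: ex_derive.
- apply: (cvgy0_le_expRN (k := s)
    (C := (s + `|t|) / (s ^+ 2 + t ^+ 2) + s^-1)) => // x x0.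
  rewrite /F normrM (ger0_norm (expR_ge0 _)) mulrC ler_wpM2r ?expR_ge0//.
  rewrite (le_trans (ler_normB _ _))// (@ger0_norm _ s^-1) ?invr_ge0 ?(ltW s0)// lerD2r.
  have st0 : 0 <= s ^+ 2 + t ^+ 2 by rewrite addr_ge0 ?sqr_ge0.
  rewrite normrM (@ger0_norm _ (_^-1)) ?invr_ge0// ler_wpM2r ?invr_ge0//.
  rewrite (le_trans (ler_normB _ _))// lerD//.
    by rewrite normrM gtr0_norm// ler_piMr ?(ltW s0)// ler_norml cos_geN1 cos_le1.
  by rewrite normrM ler_piMr// ler_norml sin_geN1 sin_le1.
Qed.

Lemma integral_sqr_div_sqrD t : 0 < t ->
  (\int[mu]_(s in `[0%R, +oo[) (t ^+ 2 / (s ^+ 2 + t ^+ 2))%:E =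
   (pi / 2 * t)%:E)%E.
Proof.
move=> t0.
have st s : s ^+ 2 + t ^+ 2 != 0.
  by rewrite gt_eqF// ltr_wpDl ?sqr_ge0 ?exprn_gt0.
pose F (s : R) := t * atan (s / t).
have dF s : is_derive s (1 : R) F (t ^+ 2 / (s ^+ 2 + t ^+ 2)).
  rewrite /F; apply: is_derive_eq; rewrite /GRing.scale /=.
  by field; rewrite (gt_eqF t0) /= st.
rewrite (ge0_integral_is_derivey (F := F) (l := (pi / 2 * t)))//.
- by rewrite /F mul0r atan0 mulr0 subr0.
- by apply: derivable_continuous => s; exact: ex_derive.
- by move=> s _; rewrite divr_ge0 ?addr_ge0 ?sqr_ge0.
- rewrite mulrC; apply: cvgMl_tmp.
  apply: (cvg_comp (fun s => s / t) (@atan R)); last exact: cvgy_atan.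
  by apply: gt0_cvgMly; rewrite ?invr_gt0//; exact: cvg_id.
Qed.

(** Up to a constant factor, the Fejer kernel on the real line. *)
Definition fejer t x : R := (1 - cos (t * x)) / x ^+ 2.

Lemma fejer_ge0 t x : 0 <= fejer t x.
Proof. by rewrite divr_ge0 ?sqr_ge0// subr_ge0 cos_le1. Qed.

Lemma fejerN t x : fejer (- t) x = fejer t x.
Proof. by rewrite /fejer mulNr cosN. Qed.

Lemma measurable_fejer t : measurable_fun [set: R] (fejer t).
Proof.
apply: measurable_funM.
- apply: measurable_funB => //; apply: measurableT_comp; first exact: measurable_cos.
  exact: measurable_funM.
- apply: measurableT_comp; first exact: measurable_invr.
  exact: measurable_funX.
Qed.

(** The half-angle formula; it makes the kernel a rescaled squared cardinal
    sine. *)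
Lemma fejerE t x : fejer t x = 2 * (sin (t * x / 2) / x) ^+ 2.
Proof.
rewrite /fejer [in LHS](_ : t * x = (t * x / 2) *+ 2); last first.
  by rewrite -mulr_natr; field.
by rewrite cos_mulr2n cos2sin2 expr_div_n; ring.
Qed.

(** Write x^-2 as the integral of s e^(-sx) over s > 0 and exchange the two
    integrals of a nonnegative function: the integral in x becomes
    t^2 / (s^2 + t^2), whose antiderivative in s is t atan (s / t). *)
Lemma integral_fejer t :
  (\int[mu]_(x in `]0%R, +oo[) (fejer t x)%:E = (pi / 2 * `|t|)%:E)%E.
Proof.
wlog t0 : t / 0 <= t.
  move=> H; have [|/ltW t0] := leP 0 t; first exact: H.
  rewrite -normrN -H ?oppr_ge0//.
  by apply: eq_integral => x _; rewrite fejerN.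
move: t0; rewrite le_eqVlt => /predU1P[<-|t0].
  rewrite normr0 mulr0 integral0_eq// => x _.
  by rewrite /fejer mul0r cos0 subrr mul0r.
pose h (z : R * R) := (1 - cos (t * z.1)) * (z.2 * expR (- (z.2 * z.1))).
have mh : measurable_fun setT h.
  apply: measurable_funM.
    apply: measurable_funB => //; apply: measurableT_comp; first exact: measurable_cos.
    by apply: measurable_funM => //; exact: measurable_fst.
  apply: measurable_funM; first exact: measurable_snd.
  apply: measurableT_comp; first exact: measurable_expR.
  apply: measurableT_comp => //.
  by apply: measurable_funM; [exact: measurable_snd|exact: measurable_fst].
have h0 z : (`]0%R, +oo[ `*` `]0%R, +oo[)%classic z -> (0 <= (h z)%:E)%E.
  move=> [_ /=]; rewrite in_itv/= andbT => z0.
  by rewrite lee_fin !mulr_ge0 ?expR_ge0 ?(ltW z0)// subr_ge0 cos_le1.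
transitivity (\int[mu]_(x in `]0%R, +oo[) \int[mu]_(s in `]0%R, +oo[)
    (h (x, s))%:E)%E.
  apply: eq_integral => x; rewrite inE/= in_itv/= andbT => x0.
  rewrite integral_itv_obnd_cbnd; last first.
    apply/measurable_EFinP; apply: measurable_funTS.
    by apply: (measurableT_comp mh); exact: measurable_pair1.
  under eq_integral do rewrite /h/= EFinM.
  rewrite ge0_integralZl_EFin//; last 2 first.
  - move=> s; rewrite /= in_itv/= andbT => s0.
    by rewrite lee_fin mulr_ge0 ?expR_ge0.
  - apply/measurable_EFinP; apply: measurable_funTS.
    apply: measurable_funM => //; apply: measurableT_comp; first exact: measurable_expR.
    by apply: measurableT_comp => //; exact: measurable_funM.
  by rewrite integral_id_expRN.
rewrite [LHS](@fubini_tonelli_setX _ _ _ _ _ mu mu _ _ (EFin \o h))//;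
    last first.
  by apply/measurable_EFinP; exact: measurable_funTS.
transitivity (\int[mu]_(s in `]0%R, +oo[) (t ^+ 2 / (s ^+ 2 + t ^+ 2))%:E)%E.
  apply: eq_integral => s; rewrite inE/= in_itv/= andbT => s0.
  rewrite integral_itv_obnd_cbnd; last first.
    apply/measurable_EFinP; apply: measurable_funTS.
    by apply: (measurableT_comp mh); exact: measurable_pair2.
  transitivity (\int[mu]_(x in `[0%R, +oo[)
     (s%:E * ((1 - cos (t * x)) * expR (- (s * x)))%:E))%E.
    by apply: eq_integral => x _; rewrite -EFinM /h/= mulrCA.
  rewrite ge0_integralZl_EFin//; last 2 first.
  - apply/measurable_EFinP; apply: measurable_funTS.
    apply: continuous_measurable_fun; apply: derivable_continuous => x.
    exact: ex_derive.
  - exact: ltW.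
  rewrite integral_one_sub_cos_expRN// -EFinM; congr EFin.
  have st : s ^+ 2 + t ^+ 2 != 0.
    by rewrite gt_eqF// ltr_pwDl ?sqr_ge0 ?exprn_gt0.
  by field; rewrite st gt_eqF.
rewrite integral_itv_obnd_cbnd; last first.
  apply/measurable_EFinP; apply: measurable_funTS.
  apply: measurable_funM => //; apply: measurableT_comp.
    exact: measurable_invr.
  by apply: measurable_funD => //; exact: measurable_funX.
by rewrite integral_sqr_div_sqrD// gtr0_norm.
Qed.

Lemma measurable_fejerD x y :
  measurable_fun [set: R] (fun w => fejer x w + fejer y w).
Proof. by apply: measurable_funD; exact: measurable_fejer. Qed.

Lemma fejerD_ge0 x y w : 0 <= fejer x w + fejer y w.
Proof. by rewrite addr_ge0// fejer_ge0. Qed.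

Lemma integral_fejerD x y :
  (\int[mu]_(w in `]0%R, +oo[) (fejer x w + fejer y w)%:E =
   (pi / 2 * (`|x| + `|y|))%:E)%E.
Proof.
rewrite ge0_integralD_EFin//; try exact: measurable_fejer; try exact: fejer_ge0.
by rewrite !integral_fejer -EFinD -mulrDr.
Qed.

End fejer_kernel.

(** * Tails of the squared cardinal sine *)

Section sinc_tails.
Context {R : realType}.
Local Notation mu := (@lebesgue_measure R).
Implicit Types k L w x : R.

Lemma sinc_sqrE x : sinc x ^+ 2 = 2^-1 * fejer 2 x.
Proof. by rewrite fejerE /sinc [2 * x]mulrC mulfK// mulrA mulVf// mul1r. Qed.

Lemma measurable_sinc_sqr : measurable_fun [set: R] (fun x => sinc x ^+ 2).
Proof.
under eq_fun do rewrite sinc_sqrE.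
by apply: measurable_funM => //; exact: measurable_fejer.
Qed.

Lemma integral_sinc_sqr :
  (\int[mu]_(x in `]0%R, +oo[) (sinc x ^+ 2)%:E = (pi / 2)%:E)%E.
Proof.
under eq_integral do rewrite sinc_sqrE EFinM.
rewrite ge0_integralZl_EFin//; last 2 first.
- by move=> x _; rewrite lee_fin fejer_ge0.
- by apply/measurable_EFinP; apply: measurable_funTS; exact: measurable_fejer.
by rewrite integral_fejer -EFinM gtr0_norm//; congr EFin; field.
Qed.

Lemma integral_sinc_sqr_le k : 0 < k ->
  (\int[mu]_(x in `[k, +oo[) (sinc x ^+ 2)%:E <= (pi / 2)%:E)%E.
Proof.
move=> k0; rewrite -integral_sinc_sqr; apply: ge0_subset_integral => //.
- by apply/measurable_EFinP; apply: measurable_funTS; exact: measurable_sinc_sqr.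
- by move=> x _; rewrite lee_fin sqr_ge0.
- by move=> x /=; rewrite !in_itv/= !andbT; exact: lt_le_trans.
Qed.

(** Finiteness of the integral is what makes the real-valued [sinc_tail] agree
    with the extended-real integral. *)
Lemma sqr_sinc_tail k : 0 < k ->
  (\int[mu]_(x in `[k, +oo[) (sinc x ^+ 2)%:E = (sinc_tail k ^+ 2)%:E)%E.
Proof.
move=> k0; rewrite /sinc_tail sqr_sqrtr; last first.
  by apply: Rintegral_ge0 => x _; exact: sqr_ge0.
rewrite /Rintegral fineK// ge0_fin_numE; last first.
  by apply: integral_ge0 => x _; rewrite lee_fin sqr_ge0.
by rewrite (le_lt_trans (integral_sinc_sqr_le k0))// ltry.
Qed.

Lemma sinc_tail_ge0 k : 0 <= sinc_tail k.
Proof. exact: sqrtr_ge0. Qed.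

(** The square is at most the full integral pi / 2, which is below pi^2. *)
Lemma sinc_tail_le_pi k : 0 < k -> sinc_tail k <= pi.
Proof.
move=> k0; rewrite -ler_sqr ?nnegrE ?sinc_tail_ge0 ?pi_ge0//.
rewrite -lee_fin -sqr_sinc_tail// (le_trans (integral_sinc_sqr_le k0))//.
by rewrite lee_fin; have := pi_ge2 R; nra.
Qed.

Lemma le_sinc_tail k1 k2 : 0 < k1 -> k1 <= k2 -> sinc_tail k2 <= sinc_tail k1.
Proof.
move=> k10 k12; rewrite -ler_sqr ?nnegrE ?sinc_tail_ge0//.
rewrite -lee_fin -!sqr_sinc_tail ?(lt_le_trans k10)//.
apply: ge0_subset_integral => //.
- by apply/measurable_EFinP; apply: measurable_funTS; exact: measurable_sinc_sqr.
- by move=> x _; rewrite lee_fin sqr_ge0.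
- by move=> x /=; rewrite !in_itv/= !andbT; exact: le_trans.
Qed.

(** Substituting x = L w / 2 turns the kernel of parameter L into L times the
    squared cardinal sine. *)
Lemma integral_fejer_tail L k : 0 < L -> 0 < k ->
  (\int[mu]_(w in `[(2 * k)%R, +oo[) (fejer L w)%:E =
   (L * sinc_tail (L * k) ^+ 2)%:E)%E.
Proof.
move=> L0 k0; rewrite EFinM -sqr_sinc_tail ?mulr_gt0//.
pose F w := L / 2 * w.
have dF w : is_derive w (1 : R) F (L / 2).
  by apply: is_derive_eq; rewrite /GRing.scale/=; ring.
have F'E : F^`()%classic = cst (L / 2).
  by apply/funext => w; rewrite derive1E; apply: derive_val.
have -> : L * k = F (2 * k) by rewrite /F; field.
rewrite (@increasing_ge0_integration_by_substitutiony _ F (fun x => sinc x ^+ 2)); last 8 first.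
- by move=> x y _ _ xy; rewrite /F ltr_pM2l// divr_gt0.
- by rewrite F'E => w _; exact: cst_continuous.
- by rewrite F'E; exact: is_cvg_cst.
- by rewrite F'E; exact: is_cvg_cst.
- split; first by move=> w _; exact: ex_derive.
  apply: cvg_at_right_filter; apply: derivable_continuous => w.
  exact: ex_derive.
- by apply: gt0_cvgMry; [rewrite divr_gt0|exact: cvg_id].
- apply: continuous_in_subspaceT => w; rewrite inE/= in_itv/= andbT => w0.
  have wn0 : w != 0.
    by rewrite gt_eqF// (lt_le_trans _ w0)// /F mulr_gt0 ?mulr_gt0 ?divr_gt0.
  apply: (@continuous_comp _ _ _ sinc (fun y : R => y ^+ 2)).
    by apply: cvgM; [exact: continuous_sin|apply: cvgV => //; exact: cvg_id].
  exact: exprn_continuous.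
- by move=> w _; exact: sqr_ge0.
rewrite -ge0_integralZl_EFin//; last 3 first.
- by move=> w _; rewrite lee_fin mulr_ge0 ?sqr_ge0// F'E /= ltW// divr_gt0.
- apply/measurable_EFinP; apply: measurable_funTS; apply: measurable_funM.
    apply: (measurableT_comp measurable_sinc_sqr); exact: measurable_funM.
  by rewrite F'E.
- exact: ltW.
apply: eq_integral => w; rewrite inE/= in_itv/= andbT => kw.
rewrite -EFinM /= F'E fejerE /sinc /F /=; congr EFin.
have wn0 : w != 0 by rewrite gt_eqF// (lt_le_trans _ kw)// mulr_gt0.
have -> : L * w / 2 = L / 2 * w by field.
change (2 * (sin (L / 2 * w) / w) ^+ 2 =
  L * ((sin (L / 2 * w) / (L / 2 * w)) ^+ 2 * (L / 2))).
by field; rewrite wn0 gt_eqF.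
Qed.

End sinc_tails.

(** * Fourier transforms of indicators of intervals *)

Section fourier_side.
Context {R : realType}.
Local Notation mu := (@lebesgue_measure R).
Implicit Types a d k p q r s w : R.

(** Real and imaginary parts of the Fourier transform at w of the indicator of an
    interval with endpoints p < q; see [cintegral_indic_expi]. *)
Definition ft_itv_re p q w : R := (sin (w * q) - sin (w * p)) / w.
Definition ft_itv_im p q w : R := (cos (w * p) - cos (w * q)) / w.

(** |g^(w)|^2 for the difference g of the indicators of intervals with endpoints
    p < q and r < s. *)
Definition ft_itvB_sqr p q r s w : R :=
  (ft_itv_re p q w - ft_itv_re r s w) ^+ 2 + (ft_itv_im p q w - ft_itv_im r s w) ^+ 2.

Lemma fejerB p q w : fejer (q - p) w =
  (1 - (cos (w * q) * cos (w * p) + sin (w * q) * sin (w * p))) / w ^+ 2.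
Proof. by rewrite /fejer [(q - p) * w]mulrC mulrBr cosB. Qed.

Lemma ft_itv_sqr p q w : ft_itv_re p q w ^+ 2 + ft_itv_im p q w ^+ 2 = 2 * fejer (q - p) w.
Proof.
rewrite fejerB /ft_itv_re /ft_itv_im !expr_div_n -mulrDl mulrA; congr (_ * _).
have := cos2Dsin2 (w * p); have := cos2Dsin2 (w * q); lra.
Qed.

(** With jumps c_j at the points x_j, |g^|^2 w^2 is the sum over j, k of
    c_j c_k cos (w (x_j - x_k)). As the c_j sum to 0, each cosine may be replaced
    by cos - 1. Pairs of opposite jumps give the terms on the right; the
    pairs (q, r) and (p, s) have equal jumps and are moved to the left so that
    every term is nonnegative. *)
Lemma ft_itvB_sqrE p q r s w :
  ft_itvB_sqr p q r s w + 2 * (fejer (q - r) w + fejer (p - s) w) =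
  2 * (fejer (q - p) w + fejer (s - r) w + (fejer (q - s) w + fejer (p - r) w)).
Proof.
rewrite /ft_itvB_sqr /ft_itv_re /ft_itv_im !fejerB -!mulrBl -!mulrDl.
rewrite !expr_div_n -mulrDl !mulrA -mulrDl; congr (_ * _).
have := cos2Dsin2 (w * p); have := cos2Dsin2 (w * q).
have := cos2Dsin2 (w * r); have := cos2Dsin2 (w * s).
lra.
Qed.

Lemma ft_itvB_sqr_ge0 p q r s w : 0 <= ft_itvB_sqr p q r s w.
Proof. by rewrite addr_ge0 ?sqr_ge0. Qed.

Lemma measurable_ft_itvB_sqr p q r s :
  measurable_fun [set: R] (ft_itvB_sqr p q r s).
Proof.
have mM (x : R) : measurable_fun [set: R] (fun w => w * x) by exact: measurable_funM.
have mcos (x : R) : measurable_fun [set: R] (fun w => cos (w * x)).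
  by apply: (measurableT_comp measurable_cos).
have msin (x : R) : measurable_fun [set: R] (fun w => sin (w * x)).
  by apply: (measurableT_comp measurable_sin).
by apply: measurable_funD; apply: measurable_funX; apply: measurable_funB;
  apply: measurable_funM; try exact: measurable_invr; exact: measurable_funB.
Qed.

(** The frequency side of Plancherel's identity. *)
Lemma integral_ft_itvB_sqr p q r s :
  (\int[mu]_(w in `]0%R, +oo[) (ft_itvB_sqr p q r s w)%:E =
   (pi * (`|q - p| + `|s - r| + (`|q - s| + `|p - r|)
          - (`|q - r| + `|p - s|)))%:E)%E.
Proof.
have /(congr1 (fun f : R -> R => \int[mu]_(w in `]0%R, +oo[) (f w)%:E)%E) /= :=
  funext (ft_itvB_sqrE p q r s).
have mD := measurable_fejerD; have D0 := fejerD_ge0.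
rewrite ge0_integralD_EFin//; last 4 first.
- exact: measurable_ft_itvB_sqr.
- by apply: (measurable_funM (f := cst 2)) => //; exact: mD.
- exact: ft_itvB_sqr_ge0.
- by move=> w; apply: mulr_ge0 => //; exact: D0.
rewrite !ge0_integralZ_EFin//; last 2 first.
- by apply: measurable_funD; exact: mD.
- by move=> w; apply: addr_ge0; exact: D0.
rewrite integral_fejerD.
rewrite (ge0_integralD_EFin (f := fun w => fejer (q - p) w + fejer (s - r) w))//.
rewrite !integral_fejerD -EFinD -!EFinM.
(* The sum is finite, hence so is the unknown integral, and it can be solved
   for. *)
case: (\int[mu]_(w in _) _)%E => [x| |] //=.
rewrite -EFinD => -[H]; congr EFin; lra.
Qed.

(** |u - v|^2 <= 2 |u|^2 + 2 |v|^2. *)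
Lemma ft_itvB_sqr_le p q r s w :
  ft_itvB_sqr p q r s w <= 4 * (fejer (q - p) w + fejer (s - r) w).
Proof.
have := ft_itv_sqr p q w; have := ft_itv_sqr r s w.
rewrite /ft_itvB_sqr.
have := sqr_ge0 (ft_itv_re p q w + ft_itv_re r s w).
have := sqr_ge0 (ft_itv_im p q w + ft_itv_im r s w).
lra.
Qed.

(** The constant is 4 times the sum of the two lengths, each at most 2 a. *)
Lemma ft_itvB_sqr_tail (a d k : R) p q r s : 0 < d -> 0 < k ->
  d <= q - p -> d <= s - r -> q - p <= 2 * a -> s - r <= 2 * a ->
  (\int[mu]_(w in `[(2 * k)%R, +oo[) (ft_itvB_sqr p q r s w)%:E <=
   (16 * a * sinc_tail (d * k) ^+ 2)%:E)%E.
Proof.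
move=> d0 k0 dpq drs pqa rsa.
have pq0 : 0 < q - p by exact: lt_le_trans dpq.
have rs0 : 0 < s - r by exact: lt_le_trans drs.
apply: (@le_trans _ _
  (\int[mu]_(w in `[(2 * k)%R, +oo[) (4 * (fejer (q - p) w + fejer (s - r) w))%:E)%E).
  apply: ge0_le_integral => //.
  - by move=> w _; rewrite lee_fin ft_itvB_sqr_ge0.
  - apply/measurable_EFinP; apply: measurable_funTS.
    exact: measurable_ft_itvB_sqr.
  - apply/measurable_EFinP; apply: measurable_funTS.
    by apply: (measurable_funM (f := cst 4)) => //; exact: measurable_fejerD.
  - by move=> w _; rewrite lee_fin ft_itvB_sqr_le.
rewrite ge0_integralZ_EFin//; last 2 first.
- exact: measurable_fejerD.
- by move=> w; exact: fejerD_ge0.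
rewrite ge0_integralD_EFin//; try exact: measurable_fejer; try exact: fejer_ge0.
rewrite !integral_fejer_tail// -EFinD -EFinM lee_fin.
have tail L : 0 < L -> d <= L -> sinc_tail (L * k) ^+ 2 <= sinc_tail (d * k) ^+ 2.
  move=> L0 dL; rewrite ler_sqr ?nnegrE ?sinc_tail_ge0//.
  by apply: le_sinc_tail; rewrite ?mulr_gt0// ler_pM2r.
have := tail _ pq0 dpq; have := tail _ rs0 drs.
have := sqr_ge0 (sinc_tail (d * k)).
set c := sinc_tail (d * k) ^+ 2.
set u := sinc_tail _ ^+ 2; set v := sinc_tail _ ^+ 2 => c0 uc vc.
have h1 : (q - p) * v <= 2 * a * c.
  by rewrite ler_pM// ?(ltW pq0)// sqr_ge0.
have h2 : (s - r) * u <= 2 * a * c.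
  by rewrite ler_pM// ?(ltW rs0)// sqr_ge0.
lra.
Qed.

Lemma cintegral_indic_expi p q (b b' : bool) w : p < q -> w != 0 ->
  cintegral (fun z =>
    (\1_[set` Interval (BSide b p) (BSide b' q)] z)%:C * expi (w * z)) =
  ft_itv_re p q w +i* ft_itv_im p q w.
Proof.
move=> pq w0; rewrite /cintegral.
set J := [set` _].
have JE (f g : R -> R) : (forall z, g z = \1_J z * f z) ->
    Rintegral mu setT g = Rintegral mu J f.
  move=> gE; rewrite [RHS]Rintegral_mkcond; apply: eq_Rintegral => z _.
  by rewrite gE patch_indic /= mulrC.
rewrite (JE (fun z => cos (w * z))) => [|z]; last first.
  by rewrite /= mul0r subr0.
rewrite (JE (fun z => sin (w * z))) => [|z]; last first.
  by rewrite /= mul0r addr0.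
have dsin x : is_derive x (1 : R) (fun z => sin (w * z) / w) (cos (w * x)).
  by apply: is_derive_eq; rewrite /GRing.scale/=; field.
have dcos x : is_derive x (1 : R) (fun z => - cos (w * z) / w) (sin (w * x)).
  by apply: is_derive_eq; rewrite /GRing.scale/=; field.
rewrite /J (Rintegral_itv_is_derive b b' pq dsin); last first.
  by apply: derivable_continuous => x; exact: ex_derive.
rewrite (Rintegral_itv_is_derive b b' pq dcos); last first.
  by apply: derivable_continuous => x; exact: ex_derive.
by congr (_ +i* _); rewrite /ft_itv_re /ft_itv_im; field.
Qed.

(** The weight w^2 cancels the modulus 1 / (2 w) of the prefactor of [Gamma]. *)
Lemma sqr_normc_Gamma_indicB p q r s (b b' c c' : bool) w :
  p < q -> r < s -> 0 < w ->
  w ^+ 2 * ComplexField.Normc.normc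
    (Gamma (fun z => (\1_[set` Interval (BSide b p) (BSide b' q)] z)%:C) w -
     Gamma (fun z => (\1_[set` Interval (BSide c r) (BSide c' s)] z)%:C) w) ^+ 2
  = ft_itvB_sqr p q r s w / 4.
Proof.
move=> pq rs w0; have wn0 : w != 0 by rewrite gt_eqF.
rewrite /Gamma !cintegral_indic_expi// -mulrBr !ComplexField.Normc.normcM.
rewrite ComplexField.Normc.normcV /=.
rewrite !expr0n /= !expr1n add0r addr0 sqrtr1 mul1r sqrtr_sqr.
rewrite exprMn sqr_sqrtr ?addr_ge0 ?sqr_ge0// -/(ft_itvB_sqr p q r s w).
by rewrite exprVn real_normK ?num_real//; field.
Qed.

End fourier_side.

(** * The L2 distance between indicators of intervals *)

Section L2_side.
Context {R : realType}.
Local Notation mu := (@lebesgue_measure R).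
Implicit Types a d p q r s : R.

(** Containment bounds the measure, which excludes unbounded intervals; the
    lower bound on the measure excludes empty ones. *)
Lemma itv_of_lt_measure (a d : R) (J : interval R) :
  [set` J] `<=` `]-a, a[ -> 0 < d -> (d%:E < mu [set` J])%E ->
  exists b p b' q, [/\ J = Interval (BSide b p) (BSide b' q),
    p < q, d <= q - p & q - p <= 2 * a].
Proof.
move=> Ja d0 dJ.
have muJ : (mu [set` J] <= mu `](- a)%R, a[%classic)%E.
  by apply: le_measure; rewrite ?inE//=.
have muJoo : (mu [set` J] < +oo)%E.
  apply: le_lt_trans muJ _; rewrite lebesgue_measure_itv/=.
  by case: ifP => _; rewrite ?ltry.
case: J Ja dJ muJ muJoo => -[b p|[]] [b' q|[]] Ja;
  rewrite !lebesgue_measure_itv//=;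
  try (by rewrite lte_fin => /(lt_trans d0); rewrite ltxx);
  try (by rewrite ?ltry ?ltNyr/= => _ _; rewrite ltxx).
move=> + + _; rewrite !lte_fin; case: ifPn => pq; last first.
  by rewrite lte_fin => /(lt_trans d0); rewrite ltxx.
rewrite -EFinB lte_fin => dpq.
case: ifPn => aa; last first.
  by rewrite lee_fin leNgt (lt_trans d0 dpq).
rewrite lee_fin opprK => pqa.
exists b, p, b', q; split => //; first exact: ltW.
by rewrite mulr_natl mulr2n.
Qed.

(** The length of the overlap of two intervals in terms of the distances between
    their endpoints, which is the form that the frequency side produces. *)
Lemma itv_overlapE p q r s : p < q -> r < s ->
  2 * Num.max 0 (Num.min q s - Num.max p r) =
  `|q - r| + `|p - s| - (`|q - s| + `|p - r|).
Proof.
move=> pq rs.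
case: (leP 0 (_ - _));
  case: (leP q s) => ?; case: (leP p r) => ? ?;
  case: (ger0P (q - r)) => ?; case: (ger0P (p - s)) => ?;
  case: (ger0P (q - s)) => ?; case: (ger0P (p - r)) => ?; lra.
Qed.

Lemma poweR2_expe (x : \bar R) : (0 <= x)%E -> (x `^ 2 = x ^+ 2)%E.
Proof.
case: x => [x| |]//.
  by rewrite lee_fin => x0; rewrite poweR_EFin powR_mulrn.
by move=> _; rewrite poweRyr.
Qed.

Lemma L2norm_sqr (I : interval R) (g : R -> R) :
  (L2norm I g ^+ 2 = \int[mu]_(x in [set` I]) (g x ^+ 2)%:E)%E.
Proof.
rewrite /L2norm -poweR2_expe ?Lnorm_ge0// powR_Lnorm// [RHS]integral_mkcond.
apply: eq_integral => x _ /=; rewrite !patchE; case: ifPn => _.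
  by rewrite powR_mulrn// real_normK// num_real.
by rewrite powR_mulrn// normr0 expr0n.
Qed.

(** The intersection lies between the open and the closed interval with the same
    endpoints, and these have equal measure whatever the types of the bounds. *)
Lemma lebesgue_measure_itv_bndI p q r s (b b' c c' : bool) :
  mu ([set` Interval (BSide b p) (BSide b' q)] `&`
      [set` Interval (BSide c r) (BSide c' s)]) =
  (Num.max 0 (Num.min q s - Num.max p r))%:E.
Proof.
have itvE (d d' : bool) x y : mu [set` Interval (BSide d x) (BSide d' y)] =
    (Num.max 0 (y - x))%:E.
  rewrite lebesgue_measure_itv/= lte_fin; case: ltP => xy.
    by rewrite max_r ?subr_ge0 ?(ltW xy).
  by rewrite max_l// subr_le0.
apply/eqP; rewrite eq_le; apply/andP; split.
- rewrite -(itvE true false); apply: le_measure; rewrite ?inE//=.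
    exact: measurableI.
  move=> x [] /=; rewrite !in_itv/= le_min ge_max.
  case: b c b' c' => -[] [] []/= /andP[h1 h2] /andP[h3 h4];
   by rewrite ?h1 ?h2 ?h3 ?h4 ?ltW.
- rewrite -(itvE false true); apply: le_measure; rewrite ?inE//=.
    exact: measurableI.
  move=> x /=; rewrite !in_itv/= lt_min gt_max.
  move=> /andP[/andP[h1 h2] /andP[h3 h4]]; split.
   by case: b b' => -[]/=; rewrite ?h1 ?h3 ?ltW.
   by case: c c' => -[]/=; rewrite ?h2 ?h4 ?ltW.
Qed.

(** The space side of Plancherel's identity: the square of the difference of two
    indicators is their sum minus twice the indicator of the intersection. *)
Lemma L2norm_indicB (I : interval R) p q r s (b b' c c' : bool) :
  let J := [set` Interval (BSide b p) (BSide b' q)] in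
  let K := [set` Interval (BSide c r) (BSide c' s)] in
  J `<=` [set` I] -> K `<=` [set` I] -> p < q -> r < s ->
  (L2norm I (\1_J \- \1_K)%R ^+ 2 =
   (`|q - p| + `|s - r| + (`|q - s| + `|p - r|) - (`|q - r| + `|p - s|))%:E)%E.
Proof.
move=> J K JI KI pq rs; rewrite L2norm_sqr.
have muJ : mu J = (q - p)%:E.
  by rewrite /J lebesgue_measure_itv/= lte_fin pq.
have muK : mu K = (s - r)%:E.
  by rewrite /K lebesgue_measure_itv/= lte_fin rs.
have muJK := lebesgue_measure_itv_bndI p q r s b b' c c'.
rewrite -/J -/K in muJK.
have mI : measurable [set` I] by exact: measurable_itv.
have mJ : measurable J by exact: measurable_itv.
have mK : measurable K by exact: measurable_itv.
have mJK : measurable (J `&` K) by exact: measurableI.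
have i01 (A : set R) x : 0 <= \1_A x :> R by rewrite indicE; case: (_ \in _).
have /(congr1 (fun f : R -> R => \int[mu]_(x in [set` I]) (f x)%:E)%E) /= :
  (fun x => ((\1_J \- \1_K) x) ^+ 2 + 2 * \1_(J `&` K) x) =
  (fun x => \1_J x + \1_K x) :> (R -> R).
  apply/funext => x /=; rewrite !indicE in_setI.
  by case: (x \in J); case: (x \in K) => /=; ring.
rewrite (ge0_integralD_EFin (f := fun x => (\1_J x - \1_K x) ^+ 2))//; last 3 first.
- by apply: measurable_funX; apply: measurable_funB; exact: measurable_indic.
- by apply: (measurable_funM (f := cst 2)) => //; exact: measurable_indic.
- by move=> x; exact: sqr_ge0.
rewrite ge0_integralZ_EFin//.
rewrite ge0_integralD_EFin//; try exact: measurable_indic.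
have JKI : (J `&` K) `&` [set` I] = J `&` K by apply: setIidl => x [/JI].
have iJ : (\int[mu]_(x in [set` I]) (\1_J x)%:E = (q - p)%:E)%E.
  by rewrite integral_indic// (setIidl JI); exact: muJ.
have iK : (\int[mu]_(x in [set` I]) (\1_K x)%:E = (s - r)%:E)%E.
  by rewrite integral_indic// (setIidl KI); exact: muK.
have iJK := integral_indic mu mI mJK; rewrite JKI in iJK.
rewrite iJ iK iJK [X in (2%:E * X)%E]muJK -EFinD -EFinM itv_overlapE//.
case: (\int[mu]_(x in _) _)%E => [x| |] //=.
rewrite -EFinD => -[H]; congr EFin.
rewrite (@ger0_norm _ (q - p)) ?subr_ge0 ?(ltW pq)//.
rewrite (@ger0_norm _ (s - r)) ?subr_ge0 ?(ltW rs)//.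
lra.
Qed.

End L2_side.

Theorem proposition11 (R : realType) (a : R) (ha : 0 < a) :
  exists2 M : R, 0 < M &
  forall (delta kmax : R) (J Japp : interval R),
    0 < delta -> 0 < kmax ->
    [set` J] `<=` `]-a, a[ -> [set` Japp] `<=` `]-a, a[ ->
    (delta%:E < lebesgue_measure [set` J])%E ->
    (delta%:E < lebesgue_measure [set` Japp])%E ->
    let f : R -> R := \1_[set` J] in
    let fapp : R -> R := \1_[set` Japp] in
    let d := Gamma (fun z => (f z)%:C) in
    let dapp := Gamma (fun z => (fapp z)%:C) in
    (L2norm `]-a, a[%R (f \- fapp)%R ^+ 2 <=
       (4 / pi)%R%:E * Hnorm_sq `]0, 2 * kmax[%R (fun k => d k - dapp k)%R
       + (M * sinc_tail (delta * kmax))%R%:E)%E.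
Proof.
exists (16 * a); first by rewrite mulr_gt0.
move=> delta k J Japp delta0 k0 Ja Ja' muJ muJ'.
have [b [p [b' [q [JE pq dpq pqa]]]]] := itv_of_lt_measure Ja delta0 muJ.
have [c [r [c' [s [JE' rs drs rsa]]]]] := itv_of_lt_measure Ja' delta0 muJ'.
subst J Japp; cbv zeta.
rewrite L2norm_indicB//.
set N : R := (_ - _)%R.
pose S (D : set R) : \bar R :=
  (\int[lebesgue_measure]_(w in D) (ft_itvB_sqr p q r s w)%:E)%E.
pose low : set R := `]0, 2 * k[%classic.
pose high : set R := `[2 * k, +oo[%classic.
have S_ge0 D : (0 <= S D)%E.
  by apply: integral_ge0 => w _; rewrite lee_fin ft_itvB_sqr_ge0.
have SE : (S low + S high = (pi * N)%:E)%E.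
  rewrite -integral_ft_itvB_sqr /S /low /high -ge0_integral_setU//=; last 3 first.
  - apply/measurable_EFinP; apply: measurable_funTS.
    exact: measurable_ft_itvB_sqr.
  - by move=> w _; rewrite lee_fin ft_itvB_sqr_ge0.
  - apply/disj_setPS => w [] /=; rewrite !in_itv/= andbT.
    by move=> /andP[_ wk]; rewrite leNgt wk.
  congr (integral _ _ _); apply/seteqP; split => w /=; rewrite !in_itv/= !andbT.
    by case=> [/andP[]//|]; apply: lt_le_trans; rewrite mulr_gt0.
  by move=> ->; case: ltP => _; [left|right].
have mlow : measurable low by exact: measurable_itv.
have HE : Hnorm_sq `]0, 2 * k[%R (fun w =>
    Gamma (fun z => (\1_[set` Interval (BSide b p) (BSide b' q)] z)%:C) w -
    Gamma (fun z => (\1_[set` Interval (BSide c r) (BSide c' s)] z)%:C) w)%R =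
    (4^-1%:E * S low)%E.
  rewrite -ge0_integralZ_EFin//; last 2 first.
  - exact: measurable_ft_itvB_sqr.
  - exact: ft_itvB_sqr_ge0.
  apply: eq_integral => w; rewrite inE/= in_itv/= => /andP[w0 _].
  by rewrite sqr_normc_Gamma_indicB// mulrC.
have tail : (S high <= (16 * a * sinc_tail (delta * k) ^+ 2)%:E)%E.
  exact: ft_itvB_sqr_tail.
have c_le : sinc_tail (delta * k) ^+ 2 <= pi * sinc_tail (delta * k).
  by rewrite expr2 ler_wpM2r ?sinc_tail_ge0// sinc_tail_le_pi// mulr_gt0.
rewrite HE; move: SE tail (S_ge0 low) (S_ge0 high).
move: (S low) (S high) => [x| |] [y| |]//= [xyN].
rewrite !lee_fin => ytail _ _.
have pi0 : 0 < pi :> R := pi_gt0 R.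
rewrite -(ler_pM2l pi0) -xyN mulrDr.
have xE (t : R) : 0 < t -> t * (4 / t * (4^-1 * x)) = x.
  by move=> t0; field; rewrite gt_eqF.
rewrite xE//.
by rewrite lerD2l (le_trans ytail)// (mulrCA pi) ler_wpM2l// mulr_ge0// ltW.
Qed.
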